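(* Let $\mathrm L$ be an axiomatic extension of $\mathrm{IK}$. Then $\mathrm L$ is semisimple if and only if there is some $n\in\omega$ such that both formulas $p\vee\Box_1\neg\Box_n p$ and $\Box_n p\rightarrow\Box_{n+1}p$ are theorems of $\mathrm L$.
   Context: A modal Heyting algebra is a Heyting algebra with unary operators $\Box,\Diamond$ satisfying $\Box(x\wedge y)\approx\Box x\wedge\Box y$, $\Box\top\approx\top$, $\Diamond(x\vee y)\approx\Diamond x\vee\Diamond y$, $\Diamond\bot\approx\bot$, $\Box(x\rightarrow y)\leq\Diamond x\rightarrow\Diamond y$, and $\Diamond x\rightarrow\Box y\leq\Box(x\rightarrow y)$. Notation: $\neg x:=x\rightarrow\bot$ and $\Box_n x:=x\wedge\Box x\wedge\cdots\wedge\Box^n x$, where $\Box^n$ is a string of $n$ boxes. The (global) intuitionistic modal logic $\mathrm{IK}$ is the consequence relation on formulas in this signature over an infinite set of variables given by: $\Gamma\vdash\varphi$ iff for every modal Heyting algebra $\mathbf A$ and every homomorphism $h$ from the formula algebra to $\mathbf A$, if $h(\gamma)=\top$ for all $\gamma\in\Gamma$ then $h(\varphi)=\top$ (this consequence relation is finitary). An axiomatic extension of $\mathrm{IK}$ is a logic obtained by adding to it a set of formulas, together with all their substitution instances, as axioms. A theorem is a formula derivable from the empty set. A theory of a logic $\mathrm L$ is a set of formulas closed under $\vdash_{\mathrm L}$; a theory is simple if it is maximal among theories other than the set of all formulas; $\mathrm L$ is semisimple if every theory of $\mathrm L$ is an intersection of (a possibly empty family of) simple theories. *)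

(* Defs.v *)
From HB Require Import structures.
From mathcomp Require Import all_boot all_order.
From mathcomp Require Import classical_sets cardinality.

Set Implicit Arguments.
Unset Strict Implicit.
Unset Printing Implicit Defensive.

Local Open Scope order_scope.

(* The one-element lattice is a tbLatticeType, so trivial algebras are
   included; distributivity follows from residuation. *)
HB.mixin Record TBLattice_isHeyting (d : Order.disp_t) T
    of Order.TBLattice d T := {
  himp : T -> T -> T;
  himpP : forall x y z : T, (x `&` y <= z) = (x <= himp y z)
}.

#[short(type="heytingType")]
HB.structure Definition Heyting (d : Order.disp_t) :=
  { T of TBLattice_isHeyting d T & Order.TBLattice d T }.

HB.mixin Record Heyting_isModal (d : Order.disp_t) T of Heyting d T := {
  hbox : T -> T;
  hdia : T -> T;
  hboxI : forall x y : T, hbox (x `&` y) = hbox x `&` hbox y;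
  hbox1 : hbox \top = \top;
  hdiaU : forall x y : T, hdia (x `|` y) = hdia x `|` hdia y;
  hdia0 : hdia \bot = \bot;
  hbox_himp_le : forall x y : T, hbox (himp x y) <= himp (hdia x) (hdia y);
  hdia_himp_le : forall x y : T, himp (hdia x) (hbox y) <= hbox (himp x y)
}.

#[short(type="modalHeytingType")]
HB.structure Definition ModalHeyting (d : Order.disp_t) :=
  { T of Heyting_isModal d T & Heyting d T }.

Inductive form (V : Type) : Type :=
| Var of V
| Bot
| Top
| And of form V & form V
| Or of form V & form V
| Imp of form V & form V
| Box of form V
| Dia of form V.

Arguments Bot {V}.
Arguments Top {V}.

Definition Neg (V : Type) (x : form V) : form V := Imp x Bot.

Fixpoint Boxn (V : Type) (n : nat) (x : form V) : form V :=
  if n is m.+1 then And (Boxn m x) (iter n (@Box V) x) else x.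

Fixpoint subst (V W : Type) (s : V -> form W) (x : form V) : form W :=
  match x with
  | Var v => s v
  | Bot => Bot
  | Top => Top
  | And y z => And (subst s y) (subst s z)
  | Or y z => Or (subst s y) (subst s z)
  | Imp y z => Imp (subst s y) (subst s z)
  | Box y => Box (subst s y)
  | Dia y => Dia (subst s y)
  end.

Record is_hom (V : Type) (d : Order.disp_t) (A : modalHeytingType d)
    (h : form V -> A) : Prop := IsHom {
  hom_bot : h Bot = \bot;
  hom_top : h Top = \top;
  hom_and : forall x y, h (And x y) = h x `&` h y;
  hom_or : forall x y, h (Or x y) = h x `|` h y;
  hom_imp : forall x y, h (Imp x y) = himp (h x) (h y);
  hom_box : forall x, h (Box x) = hbox (h x);
  hom_dia : forall x, h (Dia x) = hdia (h x)
}.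

Local Close Scope order_scope.
Local Open Scope classical_set_scope.

Definition consequence (V : Type) : Type := set (form V) -> form V -> Prop.

Definition IK (V : Type) : consequence V := fun G x =>
  forall (d : Order.disp_t) (A : modalHeytingType d) (h : form V -> A),
    is_hom h -> (forall g, G g -> h g = Order.top) -> h x = Order.top.

Definition subst_instances (V : Type) (Ax : set (form V)) : set (form V) :=
  [set y | exists (s : V -> form V) (x : form V), Ax x /\ y = subst s x].

(* Axioms may be used at any point of a derivation, so adding them to IK
   amounts to adding their instances to every set of premises. *)
Definition axiomatic_extension_of_IK (V : Type) (L : consequence V) : Prop :=
  exists Ax : set (form V),
    forall G x, L G x <-> IK (G `|` subst_instances Ax) x.

Definition is_theorem (V : Type) (L : consequence V) (x : form V) : Prop :=
  L set0 x.

Definition theory (V : Type) (L : consequence V) (T : set (form V)) : Prop :=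
  forall x, L T x -> T x.

Definition simple_theory (V : Type) (L : consequence V) (T : set (form V)) :
    Prop :=
  [/\ theory L T, T <> setT &
    forall U, theory L U -> U <> setT -> T `<=` U -> U = T].

(* The intersection of the empty family is setT. *)
Definition semisimple (V : Type) (L : consequence V) : Prop :=
  forall T, theory L T ->
    exists F : set (set (form V)),
      F `<=` simple_theory L /\ T = \bigcap_(S in F) S.

(* Main.v *)
(* Write o z for z /\ []z, so that Box_n is the n-th iterate of o.

   If L is semisimple, then for every f some n makes the rule
   "x <= y and Box_(f k) ~Box_k x <= y for all k <= n imply y = top" valid.
   Constant functions f give numbers g(m) such that x \/ Box_m ~Box_(g m) x is valid, so
   ~Box_k ~Box_n x <= Box_(n - g k) x whenever g(k) <= n. The rule for
   f(k) = g(k) + 1, applied to ~Box_n x and ~Box_n x \/ Box_(n+1) x for n large,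
   then yields Box_n x <= Box_(n+1) x.

   Conversely, the two axioms make ~Box_n x a complement of Box_n x that is
   fixed by o. Hence a theory S maximal among those omitting x contains
   ~Box_n x, so every proper extension of S, containing x, is inconsistent. *)
Require Import Defs.
From HB Require Import structures.
From mathcomp Require Import all_boot all_order.
From mathcomp Require Import boolp classical_sets cardinality.

Set Implicit Arguments.
Unset Strict Implicit.
Unset Printing Implicit Defensive.

Import Order.TTheory.
Local Open Scope order_scope.

(** * Heyting algebras: residuation, negation and complements *)

Section HeytingTheory.
Context {d : Order.disp_t} {A : heytingType d}.
Implicit Types x y z : A.

Lemma himp_eq1 x y : (himp x y == \top) = (x <= y).
Proof. by rewrite -le1x -himpP meet1x. Qed.

Lemma himp_mp x y : himp x y `&` x <= y.
Proof. by rewrite himpP. Qed.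

Lemma neg_meet x z : himp x \bot `&` x <= z.
Proof. exact: le_trans (himp_mp _ _) (le0x _). Qed.

Lemma meetUl_heyting x y z : (x `|` y) `&` z = (x `&` z) `|` (y `&` z).
Proof.
apply/le_anti/andP; split.
  by rewrite himpP leUx -!himpP leUl leUr.
by rewrite leUx !lexI !leIr !leIxl ?leUl ?leUr.
Qed.

Lemma le_himp x x' y y' : x' <= x -> y <= y' -> himp x y <= himp x' y'.
Proof.
move=> xx yy; rewrite -himpP; apply: le_trans yy.
by apply: le_trans (himp_mp x y); rewrite leI2.
Qed.

Lemma himp_trans x y z : himp x y `&` himp y z <= himp x z.
Proof.
rewrite -himpP meetAC; apply: le_trans (himp_mp y z).
by rewrite meetC leI2 ?himp_mp.
Qed.

(** Distribute ~y over x \/ y = top: the part ~y /\ y vanishes and the rest lies below x. *)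
Lemma neg_le_of_joinE1 x y : x `|` y = \top -> himp y \bot <= x.
Proof.
move=> xy1; rewrite -[himp _ _]meet1x -xy1 meetUl_heyting leUx leIl /=.
by rewrite meetC (le_trans (himp_mp _ _)) ?le0x.
Qed.

Lemma negE_of_joinE1 x y : x `|` y = \top -> x `&` y = \bot -> himp x \bot = y.
Proof.
move=> xy1 xy0; apply/le_anti; rewrite -himpP meetC xy0 lexx andbT.
by apply: neg_le_of_joinE1; rewrite joinC.
Qed.

End HeytingTheory.

(** * The operator z /\ []z and its iterates *)

Section ModalTheory.
Context {d : Order.disp_t} {A : modalHeytingType d}.
Implicit Types x y z : A.

Definition boxed x := x `&` hbox x.

Lemma le_hbox x y : x <= y -> hbox x <= hbox y.
Proof. by move=> /meet_idPl <-; rewrite hboxI leIr. Qed.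

Lemma le_boxed x y : x <= y -> boxed x <= boxed y.
Proof. by move=> xy; rewrite leI2 ?le_hbox. Qed.

Lemma boxed1 : boxed \top = \top.
Proof. by rewrite /boxed hbox1 meet1x. Qed.

Lemma le_iter_boxed n x y : x <= y -> iter n boxed x <= iter n boxed y.
Proof. by move=> xy; elim: n => //= n; apply: le_boxed. Qed.

Lemma iter_boxed1 n : iter n boxed \top = \top.
Proof. by elim: n => //= n ->; rewrite boxed1. Qed.

Lemma iter_boxed_leq m n x : (m <= n)%N -> iter n boxed x <= iter m boxed x.
Proof.
move=> /subnK <-; rewrite iterD; elim: (n - m)%N => //= k IH.
by apply: le_trans IH; rewrite leIl.
Qed.

Lemma iter_boxed_le n x : iter n boxed x <= x.
Proof. exact: (@iter_boxed_leq 0). Qed.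

End ModalTheory.

(** * Homomorphisms and substitutions *)

Section Homomorphisms.
Variables (V : Type) (d : Order.disp_t) (A : modalHeytingType d).
Variables (h : form V -> A) (homh : is_hom h).

(** Box commutes with meets and meet is idempotent, so the conjunction of x, []x, ..., []^n x is the
    n-th iterate of [boxed]. *)
Lemma hom_boxn n x : h (Boxn n x) = iter n boxed (h x).
Proof.
have homB k y : h (iter k (@Box V) y) = iter k hbox (h y).
  by elim: k => //= k <-; rewrite hom_box.
elim: n => //= n <-; rewrite hom_and // hom_box // homB /boxed.
elim: n => [|n IH] //=; rewrite hom_and // hom_box // homB hboxI IH.
by rewrite [RHS]meetA -[in RHS](meetA (h (Boxn n x))) meetxx.
Qed.

Lemma hom_neg x : h (Neg x) = himp (h x) \bot.
Proof. by rewrite hom_imp // hom_bot. Qed.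

Lemma hom_imp_eq1 x y : h (Imp x y) = \top <-> h x <= h y.
Proof. by rewrite hom_imp // -himp_eq1; split=> [->|/eqP]. Qed.

End Homomorphisms.

Lemma hom_subst (V W : Type) (s : V -> form W) d (A : modalHeytingType d)
  (h : form W -> A) : is_hom h -> is_hom (h \o subst s).
Proof. by case=> *; split=> *; rewrite /=. Qed.

Lemma subst_comp (V W U : Type) (s : V -> form W) (t : W -> form U) x :
  subst t (subst s x) = subst (fun v => subst t (s v)) x.
Proof. by elim: x => //= [y -> z ->|y -> z ->|y -> z ->|y ->|y ->]. Qed.

(** * Closure properties of consequence in [IK] *)

Section IKTheory.
Local Open Scope classical_set_scope.
Variable V : Type.
Implicit Types (x y z : form V) (G H : set (form V)).

Lemma IK_prem G x : G x -> IK G x.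
Proof. by move=> Gx d A h homh; apply. Qed.

Lemma IK_cut G H x : IK H x -> (forall y, H y -> IK G y) -> IK G x.
Proof.
by move=> Hx GH d A h homh hG; apply: Hx => // y /GH; apply.
Qed.

Lemma IK_mono G H x : G `<=` H -> IK G x -> IK H x.
Proof. by move=> GH /IK_cut; apply=> y /GH /IK_prem. Qed.

Lemma IK_mp G x y : IK G (Imp x y) -> IK G x -> IK G y.
Proof.
move=> Gxy Gx d A h homh hG; apply/eqP; rewrite -le1x.
by rewrite -(Gx _ _ h) // -hom_imp_eq1 // Gxy.
Qed.

Lemma IK_box G x : IK G x -> IK G (Box x).
Proof. by move=> Gx d A h homh hG; rewrite hom_box // Gx // hbox1. Qed.

(* Lemma [IK_nset] shows that these are exactly the theories of [IK]; it plays
   the role of completeness for a Hilbert-style calculus. *)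
Record normal_set := NormalSet {
  nset :> form V -> Prop;
  nset_valid : forall x, IK set0 x -> nset x;
  nset_mp : forall x y, nset (Imp x y) -> nset x -> nset y;
  nset_box : forall x, nset x -> nset (Box x)
}.

End IKTheory.

HB.instance Definition _ V := gen_eqMixin (form V).
HB.instance Definition _ V := gen_choiceMixin (form V).

(** * The Lindenbaum-Tarski algebra of a normal set *)

Section Lindenbaum.
Variables (V : Type) (T : normal_set V).
Implicit Types x y z : form V.

(** This and the next two lemmas reduce membership in [T] to inequalities valid in all algebras, in
    place of formal derivations. *)
Lemma nset_le x y :
  (forall d (A : modalHeytingType d) (h : form V -> A), is_hom h -> h x <= h y) ->
  T (Imp x y).
Proof. by move=> le; apply: nset_valid => d A h homh _; apply/hom_imp_eq1/le. Qed.

Lemma nset_le1 x z : T x ->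
  (forall d (A : modalHeytingType d) (h : form V -> A), is_hom h -> h x <= h z) ->
  T z.
Proof. by move=> Tx /nset_le /nset_mp; apply. Qed.

Lemma nset_le2 x y z : T x -> T y ->
  (forall d (A : modalHeytingType d) (h : form V -> A),
    is_hom h -> h x `&` h y <= h z) ->
  T z.
Proof.
move=> Tx Ty le; apply: nset_mp Ty; apply: nset_mp Tx; apply: nset_le => d A h homh.
by rewrite hom_imp // -himpP le.
Qed.

Definition lind_rel x y := `[< T (Imp x y) >] && `[< T (Imp y x) >].

Lemma nset_imp_refl x : T (Imp x x).
Proof. by apply: nset_le. Qed.

Lemma nset_imp_trans y x z : T (Imp x y) -> T (Imp y z) -> T (Imp x z).
Proof.
move=> xy yz; apply: (nset_le2 xy yz) => d A h homh; rewrite !hom_imp //.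
exact: himp_trans.
Qed.

Lemma lind_rel_refl : reflexive lind_rel.
Proof. by move=> x; apply/andP; split; apply/asboolP/nset_imp_refl. Qed.

Lemma lind_rel_sym : symmetric lind_rel.
Proof. by move=> x y; rewrite /lind_rel andbC. Qed.

Lemma lind_rel_trans : transitive lind_rel.
Proof.
move=> y x z /andP[/asboolP xy /asboolP yx] /andP[/asboolP yz /asboolP zy].
by apply/andP; split; apply/asboolP/(@nset_imp_trans y).
Qed.

Definition lind_equiv := EquivRel lind_rel lind_rel_refl lind_rel_sym lind_rel_trans.

Definition lind : Type := {eq_quot lind_equiv}%qT.
HB.instance Definition _ := Choice.on lind.

Definition cls (x : form V) : lind := (\pi_{eq_quot lind_equiv} x)%qT.
Definition rep (a : lind) : form V := repr (a : {eq_quot lind_equiv}%qT).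

Lemma repK : cancel rep cls.
Proof. exact: (@reprK _ {eq_quot lind_equiv}%qT). Qed.

Implicit Types a b c : lind.

Definition lind_le a b := `[< T (Imp (rep a) (rep b)) >].

Lemma lind_rep x : T (Imp x (rep (cls x))) /\ T (Imp (rep (cls x)) x).
Proof.
have : cls x = cls (rep (cls x)) by rewrite repK.
by case/(@eqmodP _ lind_equiv)/andP=> /asboolP ? /asboolP.
Qed.

Lemma lind_le_cls x y : lind_le (cls x) (cls y) = `[< T (Imp x y) >].
Proof.
have [x1 x2] := lind_rep x; have [y1 y2] := lind_rep y.
apply/asbool_equiv_eq; split=> xy.
  by apply: nset_imp_trans x1 (nset_imp_trans xy y2).
by apply: nset_imp_trans x2 (nset_imp_trans xy y1).
Qed.

Lemma lind_le_refl : reflexive lind_le.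
Proof. by move=> a; apply/asboolP/nset_imp_refl. Qed.

Lemma lind_le_anti : antisymmetric lind_le.
Proof. by move=> a b ab; rewrite -[a]repK -[b]repK; apply/(@eqmodP _ lind_equiv). Qed.

Lemma lind_le_trans : transitive lind_le.
Proof.
by move=> b a c /asboolP ab /asboolP bc; apply/asboolP/(nset_imp_trans ab).
Qed.

HB.instance Definition _ := Order.Le_isPOrder.Build (Order.Disp tt tt) lind
  lind_le_refl lind_le_anti lind_le_trans.

Lemma clsP x y : reflect (T (Imp x y)) (cls x <= cls y).
Proof. by rewrite /Order.le /= lind_le_cls; apply: asboolP. Qed.

Lemma cls_eqP x y : T (Imp x y) -> T (Imp y x) -> cls x = cls y.
Proof. by move=> xy yx; apply/le_anti/andP; split; apply/clsP. Qed.

(** The operations act on chosen representatives; [cls_and] to [cls_dia] show that the choice does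
    not matter. *)
Definition lind_meet a b := cls (And (rep a) (rep b)).
Definition lind_join a b := cls (Or (rep a) (rep b)).
Definition lind_himp a b := cls (Imp (rep a) (rep b)).
Definition lind_box a := cls (Box (rep a)).
Definition lind_dia a := cls (Dia (rep a)).

Lemma nset_boxW x y : T (Imp x y) -> T (Imp (Box x) (Box y)).
Proof.
move=> /nset_box xy; apply: (nset_le1 xy) => d A h homh.
rewrite hom_box // !hom_imp // !hom_box // -himpP -hboxI le_hbox //.
exact: himp_mp.
Qed.

Lemma nset_diaW x y : T (Imp x y) -> T (Imp (Dia x) (Dia y)).
Proof.
move=> /nset_box xy; apply: (nset_le1 xy) => d A h homh.
by rewrite hom_box // !hom_imp // !hom_dia // hbox_himp_le.
Qed.

Lemma cls_and x y : cls (And x y) = lind_meet (cls x) (cls y).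
Proof.
have [x1 x2] := lind_rep x; have [y1 y2] := lind_rep y.
by apply: cls_eqP; [apply: (nset_le2 x1 y1)|apply: (nset_le2 x2 y2)];
  move=> d A h homh; rewrite !hom_imp // !hom_and // -himpP meetACA;
  rewrite leI2 // himp_mp.
Qed.

Lemma cls_or x y : cls (Or x y) = lind_join (cls x) (cls y).
Proof.
have [x1 x2] := lind_rep x; have [y1 y2] := lind_rep y.
by apply: cls_eqP; [apply: (nset_le2 x1 y1)|apply: (nset_le2 x2 y2)];
  move=> d A h homh; rewrite !hom_imp // !hom_or // -himpP meetC;
  rewrite meetUl_heyting leU2 // meetC himpP ?leIl ?leIr.
Qed.

Lemma cls_imp x y : cls (Imp x y) = lind_himp (cls x) (cls y).
Proof.
have [x1 x2] := lind_rep x; have [y1 y2] := lind_rep y.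
by apply: cls_eqP; [apply: (nset_le2 x2 y1)|apply: (nset_le2 x1 y2)];
  move=> d A h homh; rewrite !hom_imp // -himpP meetAC;
  apply: le_trans (himp_trans _ _ _); rewrite leI2 // himp_trans.
Qed.

Lemma cls_box x : cls (Box x) = lind_box (cls x).
Proof. by have [x1 x2] := lind_rep x; apply: cls_eqP; apply: nset_boxW. Qed.

Lemma cls_dia x : cls (Dia x) = lind_dia (cls x).
Proof. by have [x1 x2] := lind_rep x; apply: cls_eqP; apply: nset_diaW. Qed.

Lemma lind_meetP a b c : (a <= lind_meet b c) = (a <= b) && (a <= c).
Proof.
rewrite -(repK a) -(repK b) -(repK c) -cls_and.
apply/clsP/andP => [abc|[/clsP ab /clsP ac]].
  by split; apply/clsP; apply: (nset_le1 abc) => d A h homh;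
    rewrite !hom_imp // hom_and // le_himp ?leIl ?leIr.
apply: (nset_le2 ab ac) => d A h homh; rewrite !hom_imp // hom_and //.
by rewrite -himpP lexI; apply/andP; split; rewrite himpP ?leIl ?leIr.
Qed.

Lemma lind_joinP a b c : (lind_join a b <= c) = (a <= c) && (b <= c).
Proof.
rewrite -(repK a) -(repK b) -(repK c) -cls_or.
apply/clsP/andP => [abc|[/clsP ab /clsP ac]].
  by split; apply/clsP; apply: (nset_le1 abc) => d A h homh;
    rewrite !hom_imp // hom_or // le_himp ?leUl ?leUr.
apply: (nset_le2 ab ac) => d A h homh; rewrite !hom_imp // hom_or //.
rewrite -himpP meetC meetUl_heyting leUx.
by apply/andP; split; rewrite meetC himpP ?leIl ?leIr.
Qed.

HB.instance Definition _ := Order.POrder_MeetJoin_isLattice.Build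
  (Order.Disp tt tt) lind lind_meetP lind_joinP.

Lemma lind_le0x a : cls Bot <= a.
Proof.
rewrite -(repK a); apply/clsP/nset_le => d A h homh.
by rewrite hom_bot // le0x.
Qed.

Lemma lind_lex1 a : a <= cls Top.
Proof.
rewrite -(repK a); apply/clsP/nset_le => d A h homh.
by rewrite hom_top // lex1.
Qed.

HB.instance Definition _ := Order.hasBottom.Build (Order.Disp tt tt) lind lind_le0x.
HB.instance Definition _ := Order.hasTop.Build (Order.Disp tt tt) lind lind_lex1.

Lemma lind_himpP a b c : (a `&` b <= c) = (a <= lind_himp b c).
Proof.
rewrite -(repK a) -(repK b) -(repK c) /Order.meet /= -cls_and -cls_imp.
apply/clsP/clsP => abc; apply: (nset_le1 abc) => d A h homh;
  rewrite !hom_imp // hom_and // -!himpP; first by rewrite -meetA himpP.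
by rewrite meetA !himpP.
Qed.

HB.instance Definition _ := TBLattice_isHeyting.Build
  (Order.Disp tt tt) lind lind_himpP.

Lemma lind_boxI a b : lind_box (a `&` b) = lind_box a `&` lind_box b.
Proof.
rewrite -(repK a) -(repK b) /Order.meet /= -cls_and -!cls_box -cls_and.
by apply: cls_eqP; apply: nset_le => d A h homh;
  rewrite hom_box // !hom_and // hboxI // !hom_box.
Qed.

Lemma lind_box1 : lind_box \top = \top.
Proof.
rewrite /Order.top /= -cls_box.
by apply: cls_eqP; apply: nset_le => d A h homh; rewrite hom_box // !hom_top // hbox1.
Qed.

Lemma lind_diaU a b : lind_dia (a `|` b) = lind_dia a `|` lind_dia b.
Proof.
rewrite -(repK a) -(repK b) /Order.join /= -cls_or -!cls_dia -cls_or.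
by apply: cls_eqP; apply: nset_le => d A h homh;
  rewrite hom_dia // !hom_or // hdiaU // !hom_dia.
Qed.

Lemma lind_dia0 : lind_dia \bot = \bot.
Proof.
rewrite /Order.bottom /= -cls_dia.
by apply: cls_eqP; apply: nset_le => d A h homh; rewrite hom_dia // !hom_bot // hdia0.
Qed.

Lemma lind_box_himp_le a b :
  lind_box (himp a b) <= himp (lind_dia a) (lind_dia b).
Proof.
rewrite -(repK a) -(repK b) /himp /= -cls_imp -!cls_dia -cls_imp -cls_box.
apply/clsP/nset_le => d A h homh.
by rewrite hom_box // !hom_imp // !hom_dia // hbox_himp_le.
Qed.

Lemma lind_dia_himp_le a b :
  himp (lind_dia a) (lind_box b) <= lind_box (himp a b).
Proof.
rewrite -(repK a) -(repK b) /himp /= -cls_imp -cls_box -cls_dia -cls_imp -cls_box.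
apply/clsP/nset_le => d A h homh.
by rewrite hom_box // !hom_imp // hom_box // hom_dia // hdia_himp_le.
Qed.

HB.instance Definition _ := Heyting_isModal.Build (Order.Disp tt tt) lind
  lind_boxI lind_box1 lind_diaU lind_dia0 lind_box_himp_le lind_dia_himp_le.

Lemma cls_is_hom : is_hom (cls : form V -> lind).
Proof.
by split=> [||x y|x y|x y|x|x]; rewrite ?cls_and ?cls_or ?cls_imp ?cls_box ?cls_dia.
Qed.

Lemma cls_eq1P x : cls x = \top <-> T x.
Proof.
have -> : \top = cls Top by [].
split=> [clsx|Tx]; last first.
  by apply: cls_eqP; apply: (nset_le1 Tx) => d A h homh;
    rewrite hom_imp // -himpP ?hom_top // ?lex1 // leIl.
have /clsP : cls Top <= cls x by rewrite clsx.
move/nset_le1; apply=> d A h homh.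
by rewrite hom_imp // hom_top // -[himp _ _]meetx1 himp_mp.
Qed.

(** The quotient map is a homomorphism sending exactly the members of [T] to [\top], so it refutes
    every formula outside [T]. *)
Lemma IK_nset x : IK T x -> T x.
Proof.
by move=> Tx; apply/cls_eq1P/Tx; [exact: cls_is_hom|move=> y /cls_eq1P].
Qed.

End Lindenbaum.

(** * Deduction theorem and compactness for [IK] *)

Section Finitarity.
Local Open Scope classical_set_scope.
Variable V : Type.
Implicit Types (x y z : form V) (G H : set (form V)).

(** The formulas that some [Boxn n x] implies modulo [G] form a normal set containing [G] and [x],
    hence all their consequences. *)
Lemma IK_deduction G x y :
  IK (G `|` [set x]) y -> exists n, IK G (Imp (Boxn n x) y).
Proof.
pose D z := exists n, IK G (Imp (Boxn n x) z).
have D_valid z : IK set0 z -> D z.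
  move=> vz; exists 0 => d A h homh hG.
  by apply/hom_imp_eq1 => //; rewrite (vz _ _ _ homh) ?lex1 // => y [].
have D_mp z t : D (Imp z t) -> D z -> D t.
  move=> [m zt] [n zn]; exists (maxn m n) => d A h homh hG.
  have := zt _ _ _ homh hG; have := zn _ _ _ homh hG.
  rewrite !hom_imp_eq1 // !hom_boxn // !hom_imp // -himpP => zn' zt'.
  apply: le_trans zt'; rewrite lexI iter_boxed_leq ?leq_maxl //=.
  by apply: le_trans zn'; rewrite iter_boxed_leq ?leq_maxr.
have D_box z : D z -> D (Box z).
  (* One more iterate pays for the box: o^(n+1) x lies below [] o^n x. *)
  move=> [n zn]; exists n.+1 => d A h homh hG.
  have := zn _ _ _ homh hG; rewrite !hom_imp_eq1 // !hom_boxn // hom_box //=.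
  by move=> zn'; apply: leIxr; apply: le_hbox.
move=> Gxy; apply: (@IK_nset V (NormalSet D_valid D_mp D_box)).
apply: IK_mono Gxy => z /= [Gz|->].
  by exists 0 => d A h homh hG; apply/hom_imp_eq1 => //; rewrite (hG z) ?lex1.
by exists 0 => d A h homh hG; apply/hom_imp_eq1.
Qed.

(** Directedness puts both premises of modus ponens under one [F k], so the formulas derivable from
    a single [F i] form a normal set; [i0] accommodates the valid formulas. *)
Lemma IK_directed (I : Type) (i0 : I) (F : I -> set (form V)) x :
  (forall i j, exists k, F i `<=` F k /\ F j `<=` F k) ->
  IK (\bigcup_i F i) x -> exists i, IK (F i) x.
Proof.
move=> dirF; pose D z := exists i, IK (F i) z.
have D_valid z : IK set0 z -> D z by move=> vz; exists i0; apply: IK_mono vz.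
have D_mp z t : D (Imp z t) -> D z -> D t.
  move=> [i zt] [j zj]; have [k [ik jk]] := dirF i j; exists k.
  by apply: (@IK_mp _ _ z); [apply: IK_mono zt|apply: IK_mono zj].
have D_box z : D z -> D (Box z) by move=> [i zi]; exists i; apply: IK_box.
move=> Fx; apply: (@IK_nset V (NormalSet D_valid D_mp D_box)).
by apply: IK_mono Fx => z [i _ Fz]; exists i; apply: IK_prem.
Qed.

End Finitarity.

(** * Models and theories of an axiomatic extension *)

Section AxiomaticExtension.
Local Open Scope classical_set_scope.
Variables (V : Type) (L : consequence V) (Ax : set (form V)).
Hypothesis LE : forall G x, L G x <-> IK (G `|` subst_instances Ax) x.
Implicit Types (x y z : form V) (G S T : set (form V)).
Let I := subst_instances Ax.

Definition L_model d (A : modalHeytingType d) (h : form V -> A) :=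
  is_hom h /\ forall x, I x -> h x = \top.

(** Axiom instances are closed under substitution; this is how a theorem about variables passes to
    arbitrary formulas. *)
Lemma L_model_subst d (A : modalHeytingType d) (h : form V -> A)
    (s : V -> form V) : L_model h -> L_model (h \o subst s).
Proof.
move=> [homh hI]; split=> [|x [t [a [Axa ->]]]]; first exact: hom_subst.
rewrite /= subst_comp; apply: hI; exists (fun v => subst s (t v)), a.
by split.
Qed.

Lemma L_modelP G x : L G x <->
  forall d (A : modalHeytingType d) (h : form V -> A), L_model h ->
  (forall y, G y -> h y = \top) -> h x = \top.
Proof.
rewrite LE; split=> Gx d A h.
  by move=> [homh hI] hG; apply: Gx => // y [/hG|/hI].
by move=> homh hGI; apply: Gx => [|y Gy]; [split=> // y Iy|]; apply: hGI; [right|left].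
Qed.

Lemma L_mono G T x : G `<=` T -> L G x -> L T x.
Proof. by move=> GT /LE Gx; apply/LE; apply: IK_mono Gx; apply: setSU. Qed.

Lemma L_prem G x : G x -> L G x.
Proof. by move=> Gx; apply/LE/IK_prem; left. Qed.

Lemma theory_L G : theory L (L G).
Proof.
move=> x /LE LGx; apply/LE; apply: IK_cut LGx _ => y [/LE //|Iy].
by apply: IK_prem; right.
Qed.

Lemma theory_bot T : theory L T -> T Bot -> T = setT.
Proof.
move=> thT TBot; apply/seteqP; split=> // x _; apply: thT.
apply/L_modelP => d A h [homh hI] hT; apply/eqP.
by rewrite -le1x -(hT _ TBot) hom_bot // le0x.
Qed.

Lemma L_deduction G x y :
  L (G `|` [set x]) y -> exists n, L G (Imp (Boxn n x) y).
Proof.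
move=> /LE; rewrite setUAC => /IK_deduction[n Gxy].
by exists n; apply/LE.
Qed.

Lemma L_directed (J : Type) (j0 : J) (F : J -> set (form V)) x :
  (forall i j, exists k, F i `<=` F k /\ F j `<=` F k) ->
  L (\bigcup_j F j) x -> exists j, L (F j) x.
Proof.
move=> dirF /LE Fx.
have [||j Fjx] := @IK_directed V J j0 (fun j => F j `|` I) x.
- move=> i j; have [k [ik jk]] := dirF i j; exists k.
  by split; apply: setSU.
- apply: IK_mono Fx => y [[j _ Fy]|Iy]; first by exists j => //; left.
  by exists j0 => //; right.
by exists j; apply/LE.
Qed.

(** * From semisimplicity to the two axioms *)

(** By maximality, adding [x] yields all formulas, in particular [Bot], and the deduction theorem
    applies. *)
Lemma simple_theory_neg T x : simple_theory L T -> ~ T x ->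
  exists n, T (Neg (Boxn n x)).
Proof.
move=> [thT _ maxT] nTx; have [n Tn] : exists n, L T (Imp (Boxn n x) Bot).
  apply: L_deduction; suff -> : L (T `|` [set x]) = setT by [].
  apply: contrapT => LneT; apply: nTx; rewrite -(maxT _ _ LneT).
  - by apply: L_prem; right.
  - exact: theory_L.
  - by move=> y Ty; apply: L_prem; left.
by exists n; apply: thT.
Qed.

(* The premises [p -> q] and [Box_(f k) ~ Box_k p -> q] entail [q] in every
   simple theory, hence in [L]; by compactness finitely many of them suffice,
   and [p], [q] may be replaced by arbitrary formulas. *)
Lemma semisimple_rule (p q : V) (f : nat -> nat) : p <> q -> semisimple L ->
  exists n, forall d (A : modalHeytingType d) (h : form V -> A), L_model h ->
    forall x y, h x <= h y ->
    (forall k, (k <= n)%N ->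
      iter (f k) boxed (himp (iter k boxed (h x)) \bot) <= h y) ->
    h y = \top.
Proof.
move=> pq ssL.
pose prem k := Imp (Boxn (f k) (Neg (Boxn k (Var p)))) (Var q).
pose F n := [set Imp (Var p) (Var q)] `|` [set prem k | k in [set k | (k <= n)%N]].
have [T [Tsimple TE]] := ssL _ (@theory_L (\bigcup_n F n)).
have : L (\bigcup_n F n) (Var q).
  rewrite TE => S TS; have simS := Tsimple S TS; apply: contrapT => nSq.
  have [thS _ _] := simS.
  have FS : \bigcup_n F n `<=` S.
    by move=> x Fx; have := L_prem Fx; rewrite TE; apply.
  (* [p] is outside [S], since p -> q would otherwise put [q] there; simplicity then yields some
     ~Box_n p in [S]. *)
  have [|n Sn] := simple_theory_neg simS (x := Var p).
    move=> Sp; apply/nSq/thS/L_modelP => d A h [homh _] hS; apply/eqP.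
    rewrite -le1x -(hS _ Sp) -hom_imp_eq1 //; apply/hS/FS.
    by exists 0 => //; left.
  apply/nSq/thS/L_modelP => d A h [homh _] hS; apply/eqP.
  have : h (prem n) = \top by apply/hS/FS; exists n => //; right; exists n => /=.
  by rewrite hom_imp_eq1 // hom_boxn // hS // iter_boxed1 le1x.
move=> /(L_directed 0)[i j|n Fnq].
  exists (maxn i j); split; apply: setUS => _ [k /= kij <-]; exists k => //=;
    by rewrite leq_max kij ?orbT.
exists n => d A h hmod x y xy kxy; have [homh _] := hmod.
(* Equality on the arbitrary type [V] is decided classically; [pq] lets [p] and [q] be replaced
   independently. *)
pose s v := if pselect (v = p) then x else if pselect (v = q) then y else Var v.
have sp : s p = x by rewrite /s; case: (pselect (p = p)).
have sq : s q = y.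
  rewrite /s; case: (pselect (q = p)) => [qp|?]; first by case: pq.
  by case: (pselect (q = q)).
rewrite -[in LHS]sq; move/L_modelP: Fnq => /(_ _ _ _ (L_model_subst s hmod)).
apply=> z [->|[k kn <-]]; apply/(hom_imp_eq1 (hom_subst s homh)); rewrite /= ?sp ?sq //.
have homhs := hom_subst s homh.
rewrite -[leLHS]/((h \o subst s) _) hom_boxn // hom_neg // hom_boxn //= sp.
exact: kxy.
Qed.

(** Take f constantly m and y := x \/ Box_m ~Box_n x in the rule. *)
Lemma semisimple_excluded_middle (p q : V) (m : nat) : p <> q -> semisimple L ->
  exists n, forall d (A : modalHeytingType d) (h : form V -> A), L_model h ->
    forall x, (h x `|` iter m boxed (himp (iter n boxed (h x)) \bot))%O = \top.
Proof.
move=> pq ssL; have [n nP] := semisimple_rule (fun=> m) pq ssL.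
exists n => d A h hmod x; have [homh _] := hmod.
have := nP d A h hmod x (Or x (Boxn m (Neg (Boxn n x)))).
rewrite hom_or // hom_boxn // hom_neg // hom_boxn //; apply; first exact: leUl.
move=> k kn; apply: lexUr.
by apply/le_iter_boxed/le_himp => //; apply: iter_boxed_leq.
Qed.

Lemma semisimple_transitive (p q : V) : p <> q -> semisimple L ->
  exists n0, forall n, (n0 <= n)%N ->
    forall d (A : modalHeytingType d) (h : form V -> A), L_model h ->
    forall x, iter n boxed (h x) <= iter n.+1 boxed (h x).
Proof.
move=> pq ssL.
have [g gP] := choice (fun m => semisimple_excluded_middle m pq ssL).
have [n' n'P] := semisimple_rule (fun k => (g k).+1) pq ssL.
(* The bound dominates g(k) for all k <= n', so n - g(k) below is never truncated. *)
exists (\max_(k < n'.+1) g k) => n le_n d A h hmod x; have [homh _] := hmod.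
have {n'P} := n'P d A h hmod (Neg (Boxn n x)) (Or (Neg (Boxn n x)) (Boxn n.+1 x)).
rewrite hom_or // hom_neg // !hom_boxn // => EM.
(* Once ~Box_n x \/ Box_(n+1) x = top, meeting with Box_n x kills the left disjunct. *)
rewrite -[leLHS]meet1x -{}EM ?leUl //.
  by rewrite meetUl_heyting leUx neg_meet leIl.
move=> k kn; apply: lexUr.
have gkn : (g k <= n)%N.
  apply: leq_trans le_n.
  exact: (leq_bigmax (Ordinal (kn : k < n'.+1)%N)).
(* Excluded middle for Box_(n - g k) x, whose g(k)-th iterate is Box_n x. *)
have : himp (iter k boxed (himp (iter n boxed (h x)) \bot)) \bot
    <= iter (n - g k) boxed (h x).
  apply: neg_le_of_joinE1.
  by have := gP k d A h hmod (Boxn (n - g k) x); rewrite hom_boxn // -iterD subnKC.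
(* Applying o another g(k) + 1 times raises n - g(k) to n + 1. *)
by move=> /(le_iter_boxed (g k).+1); rewrite -iterD addSn subnKC.
Qed.

(** * From the two axioms to semisimplicity *)

(** Zorn's lemma for the sets that together with [T] do not entail [x]; compactness handles unions
    of chains. *)
Lemma maximal_nonconsequence T x : theory L T -> ~ T x ->
  exists S, [/\ theory L S, T `<=` S, ~ S x &
    forall y, ~ S y -> L (S `|` [set y]) x].
Proof.
move=> thT nTx.
have [|S [nSx maxS]] := @Zorn_bigcup _ (fun S => ~ L (T `|` S) x).
  move=> F FP totF LFx.
  (* The chain may be empty, so [None] stands for [T] alone. *)
  pose G (X : option {X | F X}) := T `|` (if X is Some X then sval X else set0).
  have [||[[X FX]|]] := @L_directed (option {X | F X}) None G x.
  - move=> [X|] [Y|].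
    + have [XY|YX] := totF _ _ (svalP X) (svalP Y).
        by exists (Some Y); split=> //; apply: setUS.
      by exists (Some X); split=> //; apply: setUS.
    + by exists (Some X); split=> //; apply: setUS.
    + by exists (Some Y); split=> //; apply: setUS.
    + by exists None; split=> y.
  - apply: L_mono LFx => y [Ty|[X FX Xy]]; first by exists None => //; left.
    by exists (Some (exist _ X FX)) => //; right.
  - exact: FP.
  - by rewrite /G setU0 => /thT.
(* A maximal set equals its closure, which still omits [x]. *)
have SE : S = L (T `|` S).
  apply: contrapT => neS; apply: (maxS (L (T `|` S))).
    have SL : S `<=` L (T `|` S) by move=> y Sy; apply: L_prem; right.
    by split=> // LS; apply/neS/seteqP.
  move=> LLx; apply/nSx/theory_L; apply: L_mono LLx => y [Ty|//].
  by apply: L_prem; left.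
have TS : T `<=` S by move=> y Ty; rewrite SE; apply: L_prem; left.
exists S; split=> //; first by rewrite SE; apply: theory_L.
  by rewrite SE.
move=> y nSy; apply: contrapT => nSyx; apply: (maxS (S `|` [set y])).
  split; first by move=> z Sz; left.
  by move=> /(_ y) Sy; apply/nSy/Sy; right.
by move=> LSyx; apply: nSyx; apply: L_mono LSyx => z [/TS|] ?; [left|].
Qed.

Lemma EM_transitive_semisimple n :
  (forall d (A : modalHeytingType d) (h : form V -> A), L_model h ->
   forall x, (h x `|` boxed (himp (iter n boxed (h x)) \bot))%O = \top /\
     iter n boxed (h x) <= iter n.+1 boxed (h x)) ->
  semisimple L.
Proof.
move=> EM T thT; exists [set S | simple_theory L S /\ T `<=` S].
split; first by move=> S [].
apply/seteqP; split=> [x Tx S [_ TS]|x TSx]; first exact: TS.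
apply: contrapT => nTx.
(* A theory maximal among those above [T] omitting [x] turns out simple, although [x] was assumed to
   lie in every simple theory above [T]. *)
have [S [thS TS nSx maxS]] := maximal_nonconsequence thT nTx.
apply: (nSx); apply: (TSx S); split=> //; split=> // [ST|U thU neU SU].
  by apply: nSx; rewrite ST.
pose y := Neg (Boxn n x).
have yP d (A : modalHeytingType d) (h : form V -> A) : L_model h ->
    boxed (h y) = h y /\ (h x `|` h y)%O = \top.
  move=> hmod; have [homh _] := hmod; set b := iter n boxed (h x).
  have bb : boxed b = b.
    by apply/le_anti; rewrite leIl; have [_] := EM d A h hmod x.
  have hyE : h y = himp b \bot by rewrite hom_neg // hom_boxn.
  (* Excluded middle for Box_n x itself: by [bb], its n-th iterate is [b] again. *)
  have bU : (b `|` boxed (h y))%O = \top.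
    have [] := EM d A h hmod (Boxn n x); rewrite hom_boxn // -/b.
    by rewrite (_ : iter n boxed b = b) ?hyE //; elim: (n) => //= k ->.
  have bI : (b `&` boxed (h y))%O = \bot.
    apply/eqP; rewrite -lex0 meetC hyE; apply: le_trans (himp_mp b \bot).
    by rewrite leI2 // leIl.
  (* A complement of [b] must be ~b, so o ~b, being one, equals ~b. *)
  have byE : boxed (h y) = h y by rewrite [RHS]hyE (negE_of_joinE1 bU bI).
  split=> //; apply/eqP; rewrite -le1x -bU byE leU2 //.
  exact: iter_boxed_le.
have Sy : S y.
  (* Otherwise some Box_m y, which equals y, implies x modulo [S]; with x \/ y = top this puts x in
     [S]. *)
  apply: contrapT => /maxS /L_deduction[m Sm]; apply/nSx/thS/L_modelP.
  move=> d A h hmod hS; have [homh _] := hmod; have [yy xy] := yP d A h hmod.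
  apply/eqP; rewrite -le1x -xy leUx lexx /=.
  have := hS _ (thS _ Sm); rewrite hom_imp_eq1 // hom_boxn //.
  by rewrite (_ : iter m boxed (h y) = h y) //; elim: (m) => //= k ->.
(* Any z in [U] outside [S] brings x into [U], where it clashes with y = ~Box_n x. *)
apply/seteqP; split=> // z Uz; apply: contrapT => /maxS Sz.
have Ux : U x.
  by apply: thU; apply: L_mono Sz => w [/SU //|->].
apply: neU; apply: theory_bot => //; apply/thU/L_modelP => d A h [homh _] hU.
apply/eqP; rewrite -le1x -(hU y (SU _ Sy)) hom_neg // hom_boxn // hU // hom_bot //.
by rewrite iter_boxed1 -[himp _ _]meetx1 himp_mp.
Qed.

End AxiomaticExtension.

Theorem theorem3p51 (V : Type) (infV : infinite_set (@setT V)) (p : V)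
    (L : consequence V) (extL : axiomatic_extension_of_IK L) :
  semisimple L <->
  exists n : nat,
    is_theorem L (Or (Var p) (Boxn 1 (Neg (Boxn n (Var p))))) /\
    is_theorem L (Imp (Boxn n (Var p)) (Boxn n.+1 (Var p))).
Proof.
have [Ax LE] := extL; split=> [ssL|[n [/(L_modelP LE) EM /(L_modelP LE) trans]]].
  (* The rule takes two distinct variables; infinitude of [V] supplies the second. *)
  have [q pq] : exists q, p <> q.
    apply: contrapT => noq; apply: infV; rewrite (_ : setT = [set p]%classic) //.
    apply/seteqP; split=> // x _; apply: contrapT => xp.
    by apply: noq; exists x => px; apply: xp.
  have [n1 EM] := semisimple_excluded_middle LE 1 pq ssL.
  have [n2 trans] := semisimple_transitive LE pq ssL.
  (* Both formulas persist as n grows: Box_n p decreases, so its negation increases, and the second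
     formula holds from [n2] on. *)
  exists (maxn n1 n2); split; apply/(L_modelP LE) => d A h hmod _.
    have [homh _] := hmod; rewrite hom_or // hom_boxn // hom_neg // hom_boxn //.
    apply/eqP; rewrite -le1x -(EM d A h hmod (Var p)) leU2 //.
    by apply/le_iter_boxed/le_himp => //; rewrite iter_boxed_leq // leq_maxl.
  have [homh _] := hmod; rewrite hom_imp_eq1 // !hom_boxn //.
  by apply: trans hmod _; rewrite leq_maxr.
apply: (EM_transitive_semisimple LE (n := n)) => d A h hmod x.
(* Sending every variable to [x] transfers the two theorems from [p] to [x]. *)
have [homh _] := L_model_subst (fun=> x) hmod.
have := EM _ _ _ (L_model_subst (fun=> x) hmod).
have := trans _ _ _ (L_model_subst (fun=> x) hmod).
rewrite hom_imp_eq1 // hom_or // !hom_boxn // hom_neg // hom_boxn //=.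
by move=> tr em; split; [apply: em|apply: tr].
Qed.
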